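(* For $n\ge1$, if the Riordan graph $G=G_n(g,tg)$ is io-decomposable, then its chromatic number is $$\chi(G)=\lceil\log_2 n\rceil+1.$$
   Context: Power series have coefficients in $\mathbb{Z}$ (or $\mathbb{Z}_2$); $\equiv$ means congruence mod $2$; $[t^k]u$ is the coefficient of $t^k$ in $u$. For $f(0)=0$, the Riordan graph $G_n(g,f)$ is the simple graph on $[n]=\{1,\dots,n\}$ in which, for $i>j\ge1$, $i$ and $j$ are adjacent iff $[t^{i-2}]\,g f^{\,j-1}\equiv 1$. It is proper if $g(0)\equiv f'(0)\equiv1$. A proper Riordan graph $G_n(g,f)$, with odd vertex set $V_o$ and even vertex set $V_e$, is io-decomposable if the induced subgraph $\langle V_o\rangle\cong G_{\lceil n/2\rceil}(g,f)$ via the relabeling $2k-1\mapsto k$ and the induced subgraph $\langle V_e\rangle$ is a null graph (no edges). *)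

(* Defs.v *)
From mathcomp Require Import all_boot all_order all_algebra.

Set Implicit Arguments.
Unset Strict Implicit.
Unset Printing Implicit Defensive.

Import GRing.Theory.
Local Open Scope ring_scope.

(* The value of a series at k is the coefficient [t^k]. *)
Definition fps := nat -> int.

Definition fps_one : fps := fun k => (k == 0%N)%:R.

Definition fps_t : fps := fun k => (k == 1%N)%:R.

Definition fps_mul (u v : fps) : fps :=
  fun k => \sum_(i < k.+1) u i * v (k - i)%N.

Definition fps_exp (u : fps) (m : nat) : fps := iter m (fps_mul u) fps_one.

Definition fps_deriv (u : fps) : fps := fun k => u k.+1 *+ k.+1.

Record sgraph (T : finType) := SGraph {
  adj :> rel T;
  adj_sym : symmetric adj;
  adj_irr : irreflexive adj
}.

Definition proper_coloring (T : finType) (G : sgraph T) (k : nat)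
    (c : {ffun T -> 'I_k}) : bool :=
  [forall x, forall y, G x y ==> (c x != c y)].

Definition colorable (T : finType) (G : sgraph T) (k : nat) : bool :=
  [exists c : {ffun T -> 'I_k}, proper_coloring G c].

Lemma colorable_exists (T : finType) (G : sgraph T) :
  exists k, colorable G k.
Proof.
exists #|T|; apply/existsP; exists [ffun x => enum_rank x].
apply/forallP=> x; apply/forallP=> y; apply/implyP=> Gxy.
rewrite !ffunE (inj_eq enum_rank_inj); apply: contraTneq Gxy => ->.
by rewrite adj_irr.
Qed.

Definition chromatic_number (T : finType) (G : sgraph T) : nat :=
  ex_minn (colorable_exists G).

Definition induced_adj (T : finType) (G : sgraph T) (A : {set T}) :
    rel {x : T | x \in A} :=
  fun x y => G (val x) (val y).

Lemma induced_sym (T : finType) (G : sgraph T) (A : {set T}) :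
  symmetric (@induced_adj T G A).
Proof. by move=> x y; apply: adj_sym. Qed.

Lemma induced_irr (T : finType) (G : sgraph T) (A : {set T}) :
  irreflexive (@induced_adj T G A).
Proof. by move=> x; apply: adj_irr. Qed.

Definition induced (T : finType) (G : sgraph T) (A : {set T}) :
    sgraph {x : T | x \in A} :=
  SGraph (@induced_sym T G A) (@induced_irr T G A).

Definition graph_iso (S T : finType) (G : sgraph S) (H : sgraph T)
    (h : S -> T) : Prop :=
  bijective h /\ forall x y, G x y = H (h x) (h y).

Definition null_graph (T : finType) (G : sgraph T) : Prop :=
  forall x y, ~~ G x y.

(* The vertex set {1, ..., n} is 'I_n, in which i stands for the vertex i + 1. *)
Definition label (n : nat) (i : 'I_n) : nat := i.+1.

(* The adjacency condition on labels i > j >= 1, where i - 2 and j - 1 are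
   genuine subtractions. *)
Definition riordan_edge (g f : fps) (i j : nat) : bool :=
  (fps_mul g (fps_exp f (j - 1)) (i - 2)%N == 1 %[mod 2])%Z.

Definition riordan_adj (n : nat) (g f : fps) : rel 'I_n :=
  fun x y =>
    ((label y < label x)%N && riordan_edge g f (label x) (label y))
    || ((label x < label y)%N && riordan_edge g f (label y) (label x)).

Lemma riordan_sym n g f : symmetric (@riordan_adj n g f).
Proof. by move=> x y; rewrite /riordan_adj orbC. Qed.

Lemma riordan_irr n g f : irreflexive (@riordan_adj n g f).
Proof. by move=> x; rewrite /riordan_adj ltnn. Qed.

(* Meaningful when f(0) = 0, which is part of [riordan_proper] below. *)
Definition riordan_graph (n : nat) (g f : fps) : sgraph 'I_n :=
  SGraph (@riordan_sym n g f) (@riordan_irr n g f).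

Definition riordan_proper (g f : fps) : Prop :=
  [/\ f 0%N = 0,
      (g 0%N = 1 %[mod 2])%Z &
      (fps_deriv f 0%N = 1 %[mod 2])%Z].

Definition odd_vertices (n : nat) : {set 'I_n} := [set x | odd (label x)].

Definition even_vertices (n : nat) : {set 'I_n} := [set x | ~~ odd (label x)].

Lemma relabel_subproof n (x : 'I_n) : (x./2 < uphalf n)%N.
Proof. exact: (half_leq (ltn_ord x : x.+2 <= n.+1)%N). Qed.

(* The vertex 2k - 1 is the ordinal 2k - 2, whose half k - 1 is the vertex k. *)
Definition relabel (n : nat) (x : {x : 'I_n | x \in odd_vertices n}) :
    'I_(uphalf n) :=
  Ordinal (relabel_subproof (val x)).

Definition io_decomposable (n : nat) (g f : fps) : Prop :=
  [/\ riordan_proper g f,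
      graph_iso (induced (riordan_graph n g f) (odd_vertices n))
                (riordan_graph (uphalf n) g f) (@relabel n) &
      null_graph (induced (riordan_graph n g f) (even_vertices n))].

(* Main.v *)
Require Import Defs.
From mathcomp Require Import all_boot all_order all_algebra.
From mathcomp Require Import zify.

(** Shift the vertices down by one, so that they are 0, ..., n - 1 and the
    relabeling of the odd vertices is a |-> a./2 on even numbers.  Then
    io-decomposability says two things: doubling preserves and reflects
    adjacency (as long as it stays below n), and two odd numbers are never
    adjacent.

    Upper bound ([io_rel_logn]): two vertices of the same 2-adic valuation v
    are 2 ^ v times odd numbers, hence not adjacent.  So the valuation is a
    proper coloring of the nonzero vertices; it takes values below
    up_log 2 n because 2 ^ v <= x < n, and the vertex 0 gets one more color.

    Lower bound ([bell_pow2_adj]): the up_log 2 n + 1 vertices 0, 1, 2, 4, 8, ...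
    form a clique.  By doubling, 0 ~ 2 ^ k reduces to 0 ~ 1, which is g(0) = 1
    modulo 2, and 2 ^ m ~ 2 ^ k reduces to 1 ~ 2 ^ r with r = k - m > 0.  The
    latter asks for the coefficient of t ^ (2 ^ r - 2) in g ^ 2, and since
    g(t) ^ 2 = g(t ^ 2) modulo 2 ([fps_sqr_coef_mod2]) this is the coefficient
    of t ^ (2 ^ (r - 1) - 1) in g, that is, 0 ~ 2 ^ (r - 1). *)

Import GRing.Theory.
Local Open Scope ring_scope.

(** * Coefficients of power series *)

Lemma fps_mulr1 (u : fps) k : fps_mul u fps_one k = u k.
Proof.
rewrite /fps_mul big_ord_recr /= subnn /fps_one mulr1 big1 ?add0r // => i _.
by rewrite subn_eq0 leqNgt ltn_ord mulr0.
Qed.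

Lemma fps_mul_t0 (u : fps) : fps_mul fps_t u 0%N = 0.
Proof. by rewrite /fps_mul big_ord1 /fps_t mul0r. Qed.

Lemma fps_mul_tS (u : fps) k : fps_mul fps_t u k.+1 = u k.
Proof.
rewrite /fps_mul 2!big_ord_recl /fps_t /= mul0r add0r mul1r subn1 /=.
by rewrite big1 ?addr0 // => i _; rewrite mul0r.
Qed.

Lemma fps_mul_tSr (u v : fps) k :
  fps_mul u (fps_mul fps_t v) k.+1 = fps_mul u v k.
Proof.
rewrite {1}/fps_mul big_ord_recr /= subnn fps_mul_t0 mulr0 addr0.
by apply: eq_bigr => i _; rewrite subSn ?fps_mul_tS // -ltnS.
Qed.

Lemma eq_fps_mulr (u v w : fps) : v =1 w -> fps_mul u v =1 fps_mul u w.
Proof. by move=> eqvw k; apply: eq_bigr => i _; rewrite eqvw. Qed.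

(** In the convolution sum of an even coefficient, the terms i and 2m - i are
    equal and cancel modulo 2; only the middle term, the square of the m-th
    coefficient, survives. *)
Lemma fps_sqr_coef_mod2 (u : fps) m :
  (fps_mul u u m.*2 = u m %[mod 2])%Z.
Proof.
pose F i := u i * u (m.*2 - i)%N.
have upper_half : \sum_(m.+1 <= i < m.*2.+1) F i = \sum_(0 <= i < m) F i.
  rewrite big_nat_rev /= -{1}[m.+1]add0n big_addn.
  have -> : (m.*2.+1 - m.+1 = m)%N by lia.
  rewrite !big_mkord; apply: eq_bigr => i _; have im := ltn_ord i.
  rewrite /F mulrC; congr (u _ * u _); lia.
have sumE : fps_mul u u m.*2 = u m * u m + 2 * \sum_(0 <= i < m) F i.
  rewrite /fps_mul -(big_mkord xpredT F) (big_cat_nat (n := m)) //=; last by lia.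
  rewrite (@big_ltn _ _ _ m); last by lia.
  rewrite upper_half {2}/F (_ : m.*2 - m = m)%N; last by lia.
  by rewrite addrCA -mulr2n mulr_natl.
move: sumE; set S := \sum_(_ <= _ < _) _ => ->; set a := u m; nia.
Qed.

(** * Adjacency on natural numbers *)

(** The adjacency of Riordan graphs on labels shifted down by one, free of the
    bound n so that vertices can be halved and doubled as numbers. *)
Definition riordan_rel (g f : fps) : rel nat := fun a b =>
  ((b < a)%N && riordan_edge g f a.+1 b.+1)
  || ((a < b)%N && riordan_edge g f b.+1 a.+1).

Lemma riordan_relE n g f (x y : 'I_n) :
  riordan_adj g f x y = riordan_rel g f x y.
Proof. by []. Qed.

Lemma riordan_relC g f a b : riordan_rel g f a b = riordan_rel g f b a.
Proof. by rewrite /riordan_rel orbC. Qed.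

Lemma riordan_rel_ltn g f a b :
  (a < b)%N -> riordan_rel g f a b = riordan_edge g f b.+1 a.+1.
Proof. by move=> ab; rewrite /riordan_rel ab ltnNge ltnW. Qed.

Lemma riordan_rel0 g f k :
  riordan_rel g f 0 k.+1 = (g k == 1 %[mod 2])%Z.
Proof. by rewrite riordan_rel_ltn // /riordan_edge fps_mulr1 subn2. Qed.

(** For f = tg the neighbors of 1 are read off g ^ 2, whose even coefficients
    are those of g modulo 2. *)
Lemma bell_rel1_double g s :
  (0 < s)%N ->
  riordan_rel g (fps_mul fps_t g) 1 s.*2
  = riordan_rel g (fps_mul fps_t g) 0 s.
Proof.
case: s => // s _; rewrite riordan_rel0 doubleS riordan_rel_ltn //.
rewrite /riordan_edge subn2 /= (eq_fps_mulr _ _ _ (fps_mulr1 _)) fps_mul_tSr.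
by rewrite fps_sqr_coef_mod2.
Qed.

(** * Adjacency in io-decomposable graphs *)

Lemma io_rel_double {n g f} (hio : io_decomposable n g f) a b :
  (a.*2 < n)%N -> (b.*2 < n)%N ->
  riordan_rel g f a.*2 b.*2 = riordan_rel g f a b.
Proof.
move=> an bn; case: hio => _ [_ iso] _.
have oddE c (cn : (c.*2 < n)%N) : Ordinal cn \in odd_vertices n.
  by rewrite inE /label /= odd_double.
pose x c cn := exist (fun i => i \in odd_vertices n) _ (oddE c cn).
have := iso (x a an) (x b bn).
by rewrite /= /induced_adj !riordan_relE /= !doubleK.
Qed.

Lemma io_rel_odd {n g f} (hio : io_decomposable n g f) a b :
  (a < n)%N -> (b < n)%N -> odd a -> odd b -> ~~ riordan_rel g f a b.
Proof.
move=> an bn oa ob; case: hio => _ _ null.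
have evenE c (cn : (c < n)%N) : odd c -> Ordinal cn \in even_vertices n.
  by rewrite inE /label /= negbK.
pose x c cn oc := exist (fun i => i \in even_vertices n) _ (evenE c cn oc).
exact: null (x a an oa) (x b bn ob).
Qed.

Lemma io_rel_pow2 {n g f} (hio : io_decomposable n g f) v a b :
  (2 ^ v * a < n)%N -> (2 ^ v * b < n)%N ->
  riordan_rel g f (2 ^ v * a)%N (2 ^ v * b)%N = riordan_rel g f a b.
Proof.
elim: v => [|v IHv]; first by rewrite !mul1n.
rewrite expnS -!mulnA !mul2n => an bn.
rewrite (io_rel_double hio) // IHv //; lia.
Qed.

(** Dividing both vertices by their common power of 2 leaves two odd numbers. *)
Lemma io_rel_logn {n g f} (hio : io_decomposable n g f) a b :
  (0 < a < n)%N -> (0 < b < n)%N -> logn 2 a = logn 2 b ->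
  ~~ riordan_rel g f a b.
Proof.
case/andP=> a0 an /andP[b0 bn].
have [c] := @pfactor_coprime 2 a isT a0; rewrite coprime2n mulnC => oc aE.
have [d] := @pfactor_coprime 2 b isT b0; rewrite coprime2n mulnC => od bE.
move: aE bE; set v := logn 2 a; set w := logn 2 b => aE bE vw.
rewrite -{w}vw in bE; have v0 : (0 < 2 ^ v)%N by rewrite expn_gt0.
move: an bn; rewrite aE bE => an bn; rewrite (io_rel_pow2 hio) //.
apply: (io_rel_odd hio) => //.
  by apply: leq_ltn_trans an; rewrite leq_pmull.
by apply: leq_ltn_trans bn; rewrite leq_pmull.
Qed.

Lemma io_rel0_pow2 {n g f} (hio : io_decomposable n g f) k :
  (2 ^ k < n)%N -> riordan_rel g f 0 (2 ^ k)%N.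
Proof.
move=> kn; have := @io_rel_pow2 _ _ _ hio k 0 1.
rewrite muln0 muln1 => -> //; last exact: leq_ltn_trans kn.
by rewrite riordan_rel0; case: hio => -[_ /eqP g0 _] _ _.
Qed.

Lemma bell_pow2_adj {n g} (hio : io_decomposable n g (fps_mul fps_t g)) m k :
  (m < k)%N -> (2 ^ k < n)%N ->
  riordan_rel g (fps_mul fps_t g) (2 ^ m)%N (2 ^ k)%N.
Proof.
move=> mk kn; have [r kE] : exists r, k = (m + r.+1)%N.
  by exists (k - m).-1; lia.
have le2 i : (i <= k)%N -> (2 ^ i < n)%N.
  by move=> ik; apply: leq_ltn_trans kn; rewrite leq_pexp2l.
have := @io_rel_pow2 _ _ _ hio m 1 (2 ^ r.+1)%N.
rewrite -expnD -kE muln1 => -> //; last by apply: le2; lia.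
rewrite expnS mul2n bell_rel1_double ?expn_gt0 //.
by apply: (io_rel0_pow2 hio); apply: le2; lia.
Qed.

(** * Bounds on the chromatic number *)

Lemma chromatic_number_leq {T : finType} {G : sgraph T} {k}
    (c : T -> 'I_k) :
  (forall x y, G x y -> c x != c y) -> (chromatic_number G <= k)%N.
Proof.
move=> cP; rewrite /chromatic_number; case: ex_minnP => m _; apply.
apply/existsP; exists (finfun c); apply/'forall_forallP => x y.
by rewrite !ffunE; apply/implyP/cP.
Qed.

Lemma clique_leq_chromatic_number {T : finType} {G : sgraph T} {m}
    (h : 'I_m -> T) :
  (forall i j : 'I_m, (i < j)%N -> G (h i) (h j)) ->
  (m <= chromatic_number G)%N.
Proof.
move=> hP; rewrite /chromatic_number.
case: ex_minnP => k /existsP[c /'forall_forallP cP] _.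
suff /leq_card : injective (c \o h) by rewrite !card_ord.
have neq (i j : 'I_m) : (i < j)%N -> c (h i) != c (h j).
  by move=> /hP; apply/implyP.
move=> i j /= /eqP; case: (ltngtP i j) => [/neq/negPf->|/neq|/val_inj] //.
by rewrite eq_sym => /negPf->.
Qed.

Lemma ltn_pow2_up_log k n :
  (0 < n)%N -> (2 ^ k < n)%N = (k < up_log 2 n)%N.
Proof.
move=> n0; apply/idP/idP => [kn|].
  by rewrite -(ltn_exp2l _ _ (isT : 1 < 2)%N) (leq_trans kn) ?up_logP.
by apply: contraTT; rewrite -!leqNgt; apply: up_log_min.
Qed.

(** The vertex 0 gets the extra color up_log 2 n: the default value
    logn 2 0 = 0 would clash with its odd neighbors. *)
Lemma io_chromatic_number_leq {n g f} :
  (0 < n)%N -> io_decomposable n g f ->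
  (chromatic_number (riordan_graph n g f) <= (up_log 2 n).+1)%N.
Proof.
move=> n0 hio; pose u := up_log 2 n.
have logn_lt (x : 'I_n) : (0 < x)%N -> (logn 2 x < u)%N.
  move=> x0; rewrite -ltn_pow2_up_log //.
  by apply: leq_ltn_trans (ltn_ord x); rewrite dvdn_leq ?pfactor_dvdnn.
pose color (x : 'I_n) := if x == 0%N :> nat then u else logn 2 x.
have color_lt x : (color x < u.+1)%N.
  rewrite /color; case: posnP => // x0; exact/ltnW/logn_lt.
apply: (chromatic_number_leq (fun x => Ordinal (color_lt x))) => x y.
apply: contraTneq => /(congr1 val) /=; rewrite riordan_relE /color.
case: posnP => [-> | x0]; case: posnP => [-> | y0].
- by rewrite /riordan_rel ltnn.
- by move=> uE; have := logn_lt y y0; rewrite -uE ltnn.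
- by move=> uE; have := logn_lt x x0; rewrite uE ltnn.
- by apply: (io_rel_logn hio); rewrite ?x0 ?y0 /=.
Qed.

Lemma leq_io_bell_chromatic_number {n g} :
  (0 < n)%N -> io_decomposable n g (fps_mul fps_t g) ->
  ((up_log 2 n).+1 <= chromatic_number (riordan_graph n g (fps_mul fps_t g)))%N.
Proof.
move=> n0 hio; pose v k := if k is j.+1 then (2 ^ j)%N else 0%N.
have v_lt (k : 'I_(up_log 2 n).+1) : (v k < n)%N.
  by case: k => [[|j] ?] //=; rewrite ltn_pow2_up_log.
apply: (clique_leq_chromatic_number (fun k => Ordinal (v_lt k))) => i j ij.
rewrite /= riordan_relE /=; move: (v_lt j) ij.
case: (nat_of_ord j) (nat_of_ord i) => // k [|m] /= kn mk.
  exact: (io_rel0_pow2 hio).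
exact: (bell_pow2_adj hio).
Qed.

Theorem theorem4p20 (n : nat) (g : fps) (hn : (1 <= n)%N)
    (hio : io_decomposable n g (fps_mul fps_t g)) :
  chromatic_number (riordan_graph n g (fps_mul fps_t g)) = (up_log 2 n + 1)%N.
Proof.
apply/eqP; rewrite addn1 eqn_leq io_chromatic_number_leq //.
exact: leq_io_bell_chromatic_number.
Qed.
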